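(* Let $m,n \in \mathbb{Z}/\ell^e\mathbb{Z}$ and $K \in E[\ell^e]$. Write $\operatorname{ord}(K)=\ell^u$ with $0\le u\le e$, and let $r$ with $0\le r<e$ be the integer such that $\ell^r \mid \gcd(m,n)$ and $\ell^{r+1}\nmid \gcd(m,n)$. Then there exist points $P,Q\in E[\ell^e]$ such that $K=mP+nQ$ and $\langle P,Q\rangle = E[\ell^e]$ if and only if $u+r=e$.
   Context: Setting: $\ell$ is a (small) prime, $e$ and $f$ are positive integers, and $p$ is a prime of the form $p=\ell^e\cdot f\pm 1$. $E$ is a supersingular elliptic curve defined over $\mathbb{F}_{p^2}$ with $\#E(\mathbb{F}_{p^2})=(\ell^e\cdot f)^2$. $E[\ell^e]$ is the $\ell^e$-torsion subgroup of $E$, and $E[\ell^e]\cong \mathbb{Z}/\ell^e\mathbb{Z}\times\mathbb{Z}/\ell^e\mathbb{Z}$. $\operatorname{ord}(K)$ denotes the order of the point $K$ in the group, and $\langle P,Q\rangle$ the subgroup generated by $P$ and $Q$. Divisibility of elements of $\mathbb{Z}/\ell^e\mathbb{Z}$ by powers $\ell^j$ with $j\le e$ is understood via integer representatives. The Generalized Root Extraction Problem (GREP) is: given $m,n\in\mathbb{Z}/\ell^e\mathbb{Z}$ and $K\in E[\ell^e]$, determine $P,Q$ such that $K=mP+nQ$ and $\langle P,Q\rangle=E[\ell^e]$. The claim concerns the existence of a solution to this problem. *)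

(* Defs.v *)
(* MathComp *)
From HB Require Import structures.
From mathcomp Require Import all_boot all_order all_algebra all_field.
From mathcomp Require Import ring.

Set Implicit Arguments.
Unset Strict Implicit.
Unset Printing Implicit Defensive.

Import GRing.Theory.
Local Open Scope ring_scope.

(* y^2 + a1 x y + a3 y = x^3 + a2 x^2 + a4 x + a6. The long form is needed
   because characteristics 2 and 3 are allowed. *)
Record weierstrass (k : Type) :=
  Weierstrass { a1 : k; a2 : k; a3 : k; a4 : k; a6 : k }.

Definition base_change (k k' : Type) (g : k -> k') (W : weierstrass k) :=
  Weierstrass (g (a1 W)) (g (a2 W)) (g (a3 W)) (g (a4 W)) (g (a6 W)).

Section Curve.
Variables (k : fieldType) (W : weierstrass k).

Local Notation a1 := (a1 W).
Local Notation a2 := (a2 W).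
Local Notation a3 := (a3 W).
Local Notation a4 := (a4 W).
Local Notation a6 := (a6 W).

Definition discriminant : k :=
  let b2 := a1 ^+ 2 + 4%:R * a2 in
  let b4 := 2%:R * a4 + a1 * a3 in
  let b6 := a3 ^+ 2 + 4%:R * a6 in
  let b8 := a1 ^+ 2 * a6 + 4%:R * a2 * a6 - a1 * a3 * a4
            + a2 * a3 ^+ 2 - a4 ^+ 2 in
  - (b2 ^+ 2 * b8) - 8%:R * b4 ^+ 3 - 27%:R * b6 ^+ 2 + 9%:R * b2 * b4 * b6.

Definition elliptic : bool := discriminant != 0.

(* [None] is the point at infinity. *)
Definition on_curve (P : option (k * k)) : bool :=
  if P is Some (x, y) then
    y ^+ 2 + a1 * x * y + a3 * y == x ^+ 3 + a2 * x ^+ 2 + a4 * x + a6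
  else true.

Definition negy (x y : k) : k := - y - a1 * x - a3.

Definition raw_opp (P : option (k * k)) : option (k * k) :=
  if P is Some (x, y) then Some (x, negy x y) else None.

(* Third intersection point, reflected, of the curve with the line of slope
   [s] through (x1, y1); [x2] is the abscissa of the second intersection. *)
Definition line_point (s x1 y1 x2 : k) : option (k * k) :=
  let x3 := s ^+ 2 + a1 * s - a2 - x1 - x2 in
  Some (x3, negy x3 (s * (x3 - x1) + y1)).

Definition raw_add (P Q : option (k * k)) : option (k * k) :=
  match P, Q with
  | None, _ => Q
  | _, None => P
  | Some (x1, y1), Some (x2, y2) =>
    if x1 == x2 then
      if y2 == negy x1 y1 then None
      else line_point ((3%:R * x1 ^+ 2 + 2%:R * a2 * x1 + a4 - a1 * y1)
                       / (2%:R * y1 + a1 * x1 + a3)) x1 y1 x2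
    else line_point ((y2 - y1) / (x2 - x1)) x1 y1 x2
  end.

Lemma raw_opp_on_curve P : on_curve P -> on_curve (raw_opp P).
Proof.
case: P => [[x y]|] //= /eqP H; apply/eqP; rewrite -H /negy; ring.
Qed.

Lemma same_x x y1 y2 :
  on_curve (Some (x, y1)) -> on_curve (Some (x, y2)) ->
  y2 != negy x y1 -> y1 = y2.
Proof.
move=> /eqP H1 /eqP H2 H; apply/eqP; rewrite -subr_eq0.
have : (y1 - y2) * (y2 - negy x y1) = 0.
  rewrite -(subrr (x ^+ 3 + a2 * x ^+ 2 + a4 * x + a6)) -{1}H1 -H2 /negy; ring.
by move/eqP; rewrite mulf_eq0 (subr_eq0 y2) (negPf H) orbF.
Qed.

Lemma raw_add_on_curve P Q :
  on_curve P -> on_curve Q -> on_curve (raw_add P Q).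
Proof.
case: P Q => [[x1 y1]|] [[x2 y2]|] // HP HQ.
pose g x y : k := y ^+ 2 + a1 * x * y + a3 * y
  - (x ^+ 3 + a2 * x ^+ 2 + a4 * x + a6).
have gP : g x1 y1 = 0 by apply/eqP; rewrite subr_eq0.
have gQ : g x2 y2 = 0 by apply/eqP; rewrite subr_eq0.
rewrite /raw_add; case: eqVneq => [E|nE].
  case: ifPn => // ny.
  have Ey : y1 = y2 by apply: (@same_x x1) => //; rewrite E.
  have dn0 : 2%:R * y1 + a1 * x1 + a3 != 0.
    apply: contra ny => /eqP d; rewrite -Ey -subr_eq0 /negy -d.
    by apply/eqP; ring.
  set s := _ / _; rewrite -E.
  have Hs : s * (2%:R * y1 + a1 * x1 + a3) =
            3%:R * x1 ^+ 2 + 2%:R * a2 * x1 + a4 - a1 * y1 by exact: divfK.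
  apply: (@raw_opp_on_curve (Some (_, _))) => /=.
  pose x3 := s ^+ 2 + a1 * s - a2 - x1 - x1.
  rewrite -subr_eq0; apply/eqP.
  transitivity (g x1 y1 + (x3 - x1) *
    (s * (2%:R * y1 + a1 * x1 + a3) -
     (3%:R * x1 ^+ 2 + 2%:R * a2 * x1 + a4 - a1 * y1))); last first.
    by rewrite gP Hs subrr mulr0 addr0.
  by rewrite /g /x3; ring.
have dn0 : x2 - x1 != 0 by rewrite subr_eq0 eq_sym.
set s := _ / _.
have Hs : y2 = s * (x2 - x1) + y1 by rewrite /s divfK // subrK.
apply: (@raw_opp_on_curve (Some (_, _))) => /=.
pose x3 := s ^+ 2 + a1 * s - a2 - x1 - x2.
rewrite -subr_eq0; apply/eqP/(mulfI dn0); rewrite mulr0.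
transitivity ((x2 - x3) * g x1 y1 + (x3 - x1) * g x2 y2); last first.
  by rewrite gP gQ !mulr0 addr0.
by rewrite Hs /g /x3; ring.
Qed.

Definition point : Type := {P : option (k * k) | on_curve P}.

Definition point0 : point := exist _ None isT.
Definition point_opp (P : point) : point :=
  exist _ (raw_opp (val P)) (raw_opp_on_curve (valP P)).
Definition point_add (P Q : point) : point :=
  exist _ (raw_add (val P) (val Q)) (raw_add_on_curve (valP P) (valP Q)).

End Curve.

HB.instance Definition _ (k : fieldType) (W : weierstrass k) :=
  Choice.on (point W).

(* Chord-and-tangent operations with the library's [0], [+], [-] and [*+].
   The group axioms are not proved here, hence no [zmodType] instance. *)
HB.instance Definition _ (k : fieldType) (W : weierstrass k) :=
  Algebra.hasAdd.Build (point W) (@point_add k W).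
HB.instance Definition _ (k : fieldType) (W : weierstrass k) :=
  Algebra.hasZero.Build (point W) (@point0 k W).
HB.instance Definition _ (k : fieldType) (W : weierstrass k) :=
  Algebra.hasOpp.Build (point W) (@point_opp k W).

Section Torsion.
Variables (k : fieldType) (W : weierstrass k).
Implicit Types P Q K : point W.

(* E[N]; geometric when [k] is algebraically closed. *)
Definition torsion (N : nat) : {pred point W} := [pred P | P *+ N == 0].

(* E[p] = 0, where p is the characteristic of the algebraically closed [k]. *)
Definition supersingular (p : nat) : Prop :=
  forall P, P \in torsion p -> P = 0.

Definition has_order K (d : nat) : Prop :=
  [/\ (0 < d)%N, K *+ d = 0 &
      forall j : nat, (0 < j < d)%N -> K *+ j <> 0].

Definition in_span P Q : point W -> Prop := fun T =>
  forall S : {pred point W},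
    Algebra.zmod_closed S -> P \in S -> Q \in S -> T \in S.

(* E[N] is a subgroup, isomorphic to Z/N x Z/N (for N > 1). *)
Definition full_torsion (N : nat) : Prop :=
  Algebra.zmod_closed (torsion N) /\
  exists phi : point W -> 'Z_N * 'Z_N,
    [/\ {in torsion N &, {morph phi : P Q / P + Q}},
        {in torsion N &, injective phi} &
        forall z, exists2 P, P \in torsion N & phi P = z].

End Torsion.

Arguments torsion {k} W N.

(* Main.v *)
(* The given isomorphism turns l^e-torsion points into vectors over Z/l^e, and
   a pair of torsion points generates iff its 2x2 coordinate matrix B is
   invertible. Then K = (m, n) B has the same additive order as (m, n), namely
   l^(e-r). Conversely a vector of order l^(e-r) is l^r times a unimodular
   vector; both (m, n) and K are therefore l^r times first rows of matrices of
   determinant 1, and B is obtained from the quotient of these matrices. *)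
Require Import Defs.
From mathcomp Require Import all_boot all_order all_algebra all_field.
From mathcomp Require Import ring.

Set Implicit Arguments.
Unset Strict Implicit.
Unset Printing Implicit Defensive.

Import GRing.Theory.
Local Open Scope ring_scope.

Lemma pair_mulrn (U V : nmodType) (x : U) (y : V) c :
  (x, y) *+ c = (x *+ c, y *+ c).
Proof. by elim: c => // c IH; rewrite !mulrS IH. Qed.

(** * Row vectors and 2x2 matrices over a commutative ring *)

Section Combinations.
Variable R : comNzRingType.
Implicit Types (a b c d m n : R) (p q : R * R).

(** The row vector (a, b) times the matrix with rows [p] and [q]. *)
Definition comb a b p q : R * R := (a * p.1 + b * q.1, a * p.2 + b * q.2).

Lemma comb_mulrn a b p q (k : nat) :
  comb a b p q *+ k = comb (a *+ k) (b *+ k) p q.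
Proof.
by elim: k => [|k IH]; rewrite ?mulrS ?IH; congr pair; rewrite /= ?mulr0n; ring.
Qed.

(** Cramer's rule: at determinant 1 the adjugate is the inverse. *)
Lemma det1_generates p q : p.1 * q.2 - p.2 * q.1 = 1 ->
  forall z, exists a b, z = comb a b p q.
Proof.
move=> pq1 z; exists (z.1 * q.2 - z.2 * q.1), (z.2 * p.1 - z.1 * p.2).
rewrite [LHS]surjective_pairing -[z.1 in LHS]mulr1 -[z.2 in LHS]mulr1 -pq1.
by congr pair; rewrite /=; ring.
Qed.

(** Writing the two unit vectors as combinations gives a left inverse of the matrix with rows [p]
    and [q], so its determinant is a unit and its kernel is trivial. *)
Lemma generating_comb_eq0 p q :
  (forall z, exists a b, z = comb a b p q) ->
  forall m n, comb m n p q = 0 -> m = 0 /\ n = 0.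
Proof.
move=> gen m n [mn1 mn2].
have [a [b [ab1 ab2]]] := gen (1, 0); have [c [d [cd1 cd2]]] := gen (0, 1).
pose D := p.1 * q.2 - p.2 * q.1.
have DD : (a * d - b * c) * D = 1.
  (* The determinant of the product, which is the identity matrix. *)
  transitivity ((a * p.1 + b * q.1) * (c * p.2 + d * q.2)
                - (a * p.2 + b * q.2) * (c * p.1 + d * q.1)).
    by rewrite /D; ring.
  by rewrite -ab1 -ab2 -cd1 -cd2; ring.
split.
- rewrite -[m]mulr1 -DD.
  (* The adjugate turns the two vanishing coordinates into [m * D]. *)
  transitivity ((a * d - b * c) *
     (q.2 * (m * p.1 + n * q.1) - q.1 * (m * p.2 + n * q.2))).
    by rewrite /D; ring.
  by rewrite mn1 mn2; ring.
- rewrite -[n]mulr1 -DD.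
  transitivity ((a * d - b * c) *
     (p.1 * (m * p.2 + n * q.2) - p.2 * (m * p.1 + n * q.1))).
    by rewrite /D; ring.
  by rewrite mn1 mn2; ring.
Qed.

(** Take M with rows (m, n), (s, t) and X with rows (x, y), (s', t'). The witnesses are the rows of
    B = M^-1 X: it has determinant 1, and (x, y) is the first row of M B = X. *)
Lemma unimodular_transfer m n s t x y s' t' :
  m * t - n * s = 1 -> x * t' - y * s' = 1 ->
  exists p q, (x, y) = comb m n p q /\
    forall z, exists a b, z = comb a b p q.
Proof.
move=> mn xy.
exists (t * x - n * s', t * y - n * t'), (m * s' - s * x, m * t' - s * y).
split.
  rewrite -[x in LHS]mul1r -[y in LHS]mul1r -mn.
  by congr pair; rewrite /=; ring.
apply: det1_generates; rewrite /=.
by rewrite -[RHS]mulr1 -{1}mn -xy; ring.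
Qed.

End Combinations.

(** * Valuations and additive orders in Z/l^e *)

Section ZmodPrimePower.
Variables (l e : nat).
Hypotheses (l_prime : prime l) (e_gt0 : (0 < e)%N).
Implicit Types x y : 'Z_(l ^ e).

Lemma pexp_gt1 : (1 < l ^ e)%N.
Proof. by rewrite -(expn0 l) ltn_exp2l ?prime_gt1. Qed.

Lemma Zp_nat_eq0 c : (c%:R == 0 :> 'Z_(l ^ e)) = (l ^ e %| c)%N.
Proof. by rewrite -val_eqE /= val_Zp_nat ?pexp_gt1. Qed.

(** With gcd = g l^r and g prime to l, the condition l^e | c g l^r reduces to l^(e-r) | c. *)
Lemma Zp_pair_mulrn_eq0 r x y : (r < e)%N ->
  (l ^ r %| gcdn x y)%N -> ~~ (l ^ r.+1 %| gcdn x y)%N ->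
  forall c, (((x, y) : 'Z_(l ^ e) * 'Z_(l ^ e)) *+ c == 0)
            = (l ^ (e - r) %| c)%N.
Proof.
move=> r_lt_e dv ndv c.
rewrite pair_mulrn xpair_eqE -[x in LHS]natr_Zp -[y in LHS]natr_Zp -!mulrnA.
rewrite !Zp_nat_eq0.
rewrite -dvdn_gcd -muln_gcdl.
case/dvdnP: dv ndv => g ->; rewrite expnS dvdn_pmul2r ?expn_gt0 ?prime_gt0 //.
move=> ndv; rewrite -{1}(subnK (ltnW r_lt_e)) expnD mulnAC.
rewrite dvdn_pmul2r ?expn_gt0 ?prime_gt0 // Gauss_dvdr //.
by rewrite coprimeXl // prime_coprime.
Qed.

(** If l^e divided the gcd of the representatives, both entries would vanish; so the l-adic
    valuation of this gcd is below e. *)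
Lemma Zp_pair_valuation x y : (x, y) != 0 ->
  exists r, [/\ (r < e)%N, (l ^ r %| gcdn x y)%N & ~~ (l ^ r.+1 %| gcdn x y)%N].
Proof.
move=> nz.
have dv0 (z : 'Z_(l ^ e)) : (l ^ e %| z)%N -> z = 0.
  by move=> dz; rewrite -[z]natr_Zp; apply/eqP; rewrite Zp_nat_eq0.
have ndv : ~~ (l ^ e %| gcdn x y)%N.
  by apply: contra nz; rewrite dvdn_gcd => /andP[/dv0-> /dv0->].
have gt0 : (0 < gcdn x y)%N by case: (gcdn x y) ndv; rewrite ?dvdn0.
exists (logn l (gcdn x y)).
by rewrite !pfactor_dvdn // leqnn ltnn; split; rewrite // ltnNge -pfactor_dvdn.
Qed.

(** After division by l^r some entry is prime to l, hence a unit; its inverse, up to sign, completes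
    the row to determinant 1. *)
Lemma Zp_unimodular_factor r x y :
  (l ^ r %| gcdn x y)%N -> ~~ (l ^ r.+1 %| gcdn x y)%N ->
  exists x' y' s t : 'Z_(l ^ e),
    [/\ x = x' *+ l ^ r, y = y' *+ l ^ r & x' * t - y' * s = 1].
Proof.
rewrite !dvdn_gcd => /andP[dx dy] ndv.
have lr_gt0 : (0 < l ^ r)%N by rewrite expn_gt0 prime_gt0.
pose x' := (x %/ l ^ r)%N; pose y' := (y %/ l ^ r)%N.
have ex : x = x'%:R *+ l ^ r by rewrite -mulrnA divnK // natr_Zp.
have ey : y = y'%:R *+ l ^ r by rewrite -mulrnA divnK // natr_Zp.
have unitE (c : nat) : ((c%:R : 'Z_(l ^ e)) \is a GRing.unit) = ~~ (l %| c)%N.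
  by rewrite unitZpE ?pexp_gt1 // coprime_pexpl // prime_coprime.
have : ((x'%:R : 'Z_(l ^ e)) \is a GRing.unit)
    || ((y'%:R : 'Z_(l ^ e)) \is a GRing.unit).
  rewrite !unitE -negb_and; apply: contra ndv => /andP[lx ly].
  by rewrite -(divnK dx) -(divnK dy) expnS !dvdn_pmul2r // lx.
case/orP=> u.
- exists x'%:R, y'%:R, 0, (x'%:R)^-1; split=> //.
  by rewrite mulrV // mulr0 subr0.
- exists x'%:R, y'%:R, (- (y'%:R)^-1), 0; split=> //.
  by rewrite mulr0 mulrN mulrV // opprK add0r.
Qed.

End ZmodPrimePower.

(** * Elementary rules for points, without associativity *)

Section Points.
Variables (k : fieldType) (W : weierstrass k).
Implicit Types P Q : point W.

Lemma point_addr0 P : P + 0 = P.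
Proof. by apply: val_inj; case: P => -[[x y]|]. Qed.

Lemma point_add0r P : 0 + P = P.
Proof. exact: val_inj. Qed.

Lemma point_opprK P : - - P = P.
Proof.
apply: val_inj; case: P => -[[x y]|] //= _; congr (Some (_, _)).
by rewrite /negy; ring.
Qed.

Lemma point_subrr P : P - P = 0.
Proof. by apply: val_inj; case: P => -[[x y]|] //= _; rewrite !eqxx. Qed.

Lemma point_mulrS P c : P *+ c.+1 = P + P *+ c.
(* [P *+ 1] is [P] itself rather than [P + 0], so only c = 0 needs an argument. *)
Proof. by case: c => //; rewrite point_addr0. Qed.

Section ClosedPredicate.
Variable S : {pred point W}.
Hypothesis S_closed : Algebra.zmod_closed S.

Lemma closed_oppr P : P \in S -> - P \in S.
Proof. by case: S_closed => S0 SB /(SB _ _ S0); rewrite point_add0r. Qed.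

Lemma closed_addr P Q : P \in S -> Q \in S -> P + Q \in S.
Proof.
move=> SP /closed_oppr SQ; rewrite -(point_opprK Q).
by case: S_closed => _; apply.
Qed.

Lemma closed_mulrn P c : P \in S -> P *+ c \in S.
Proof.
move=> SP; elim: c => [|c IH]; first by case: S_closed.
by rewrite point_mulrS closed_addr.
Qed.

End ClosedPredicate.

(** * Coordinates of torsion points *)

Section TorsionCoordinates.
Variable N : nat.
Hypothesis closed : Algebra.zmod_closed (torsion W N).
Variable phi : point W -> 'Z_N * 'Z_N.
Hypothesis phiD : {in torsion W N &, {morph phi : P Q / P + Q}}.
Hypothesis phi_inj : {in torsion W N &, injective phi}.
Hypothesis phi_surj : forall z, exists2 P, P \in torsion W N & phi P = z.

Lemma coord0 : phi 0 = 0.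
Proof.
have T0 : 0 \in torsion W N by case: closed.
(* Cancellation happens in the target group; on points only 0 + 0 = 0 is used. *)
by apply: (@addIr _ (phi 0)); rewrite -phiD // point_add0r add0r.
Qed.

Lemma coordN P : P \in torsion W N -> phi (- P) = - phi P.
Proof.
move=> TP; apply: (@addrI _ (phi P)).
by rewrite -phiD ?closed_oppr // point_subrr coord0 subrr.
Qed.

Lemma coordMn P c : P \in torsion W N -> phi (P *+ c) = phi P *+ c.
Proof.
move=> TP; elim: c => [|c IH]; first exact: coord0.
by rewrite point_mulrS phiD ?closed_mulrn // IH mulrS.
Qed.

Lemma coord_mulrn_eq0 P c :
  P \in torsion W N -> (phi P *+ c == 0) = (P *+ c == 0).
Proof.
move=> TP; rewrite -coordMn // -coord0 (inj_in_eq phi_inj) ?closed_mulrn //.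
by case: closed.
Qed.

Lemma coord_comb P Q (a b : 'Z_N) :
  P \in torsion W N -> Q \in torsion W N ->
  phi (P *+ a + Q *+ b) = comb a b (phi P) (phi Q).
Proof.
move=> TP TQ; rewrite phiD ?closed_mulrn // !coordMn //.
have mulrnE (z : 'Z_N * 'Z_N) (c : 'Z_N) : z *+ c = (c * z.1, c * z.2).
  rewrite [z]surjective_pairing pair_mulrn -[c in RHS]natr_Zp.
  by rewrite !mulr_natl.
by rewrite !mulrnE.
Qed.

Lemma spans_torsionP P Q : P \in torsion W N -> Q \in torsion W N ->
  (forall T, in_span P Q T <-> T \in torsion W N) <->
  (forall z, exists a b, z = comb a b (phi P) (phi Q)).
Proof.
move=> TP TQ; split=> [span z | gen T].
  (* [in_span] is tested on the torsion points whose coordinates are combinations; finiteness of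
     ['Z_N] makes this predicate boolean. *)
  pose S : {pred point W} := [pred T | (T \in torsion W N) &&
    [exists a, exists b, phi T == comb a b (phi P) (phi Q)]].
  have SP T : reflect (T \in torsion W N /\
      exists a b, phi T = comb a b (phi P) (phi Q)) (T \in S).
    apply: (iffP andP) => [[TT /existsP[a /existsP[b /eqP]]]|[TT [a [b E]]]].
      by move=> E; split; last by exists a, b.
    by split=> //; apply/existsP; exists a; apply/existsP; exists b; apply/eqP.
  have S_closed : Algebra.zmod_closed S.
    split=> [|U V /SP[TU [a [b EU]]] /SP[TV [c [d EV]]]]; apply/SP.
      split; first by case: closed.
      by exists 0, 0; rewrite coord0 /comb !mul0r addr0.
    split; first by case: closed => _; apply.
    exists (a - c), (b - d); rewrite phiD ?closed_oppr // coordN // EU EV.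
    by congr pair; rewrite /=; ring.
  have [T TT <-] := phi_surj z.
  have : T \in S.
    apply: (proj2 (span T) TT) => //; apply/SP; split=> //.
      by exists 1, 0; rewrite /comb !mul0r !mul1r !addr0 -surjective_pairing.
    by exists 0, 1; rewrite /comb !mul0r !mul1r !add0r -surjective_pairing.
  by case/SP.
split=> [/(_ _ closed TP TQ) // | TT S S_closed SP SQ].
have [a [b E]] := gen (phi T).
have -> : T = P *+ a + Q *+ b.
  by apply: phi_inj; rewrite ?coord_comb // closed_addr ?closed_mulrn.
by rewrite closed_addr ?closed_mulrn.
Qed.

End TorsionCoordinates.

(** Annihilation by l^u gives s <= u; minimality of l^u, tested at l^s, excludes s < u. *)
Lemma has_order_pexp l s u P : prime l ->
  (forall c, (P *+ c == 0) = (l ^ s %| c)%N) -> has_order P (l ^ u) -> u = s.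
Proof.
move=> l_prime ann [_ /eqP Pu Pmin]; have l_gt1 := prime_gt1 l_prime.
apply/eqP; rewrite eqn_leq -(dvdn_Pexp2l s u l_gt1) -ann Pu andbT.
rewrite -(leq_exp2l _ _ l_gt1) leqNgt; apply/negP=> lt.
apply: (Pmin (l ^ s)%N); first by rewrite lt expn_gt0 prime_gt0.
by apply/eqP; rewrite ann.
Qed.

End Points.

Theorem theorem4 (l e f p : nat)
    (l_prime : prime l) (e_gt0 : (0 < e)%N) (f_gt0 : (0 < f)%N)
    (p_prime : prime p)
    (p_form : (p = l ^ e * f + 1)%N \/ (p = l ^ e * f - 1)%N)
    (F : finFieldType) (cardF : #|F| = (p ^ 2)%N)
    (L : closedFieldType) (iota : {rmorphism F -> L})
    (L_algebraic : forall x : L, algebraicOver iota x)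
    (E : weierstrass F) (E_elliptic : elliptic E)
    (E_supersingular : supersingular (base_change iota E) p)
    (cardE : #|{: point E}| = ((l ^ e * f) ^ 2)%N)
    (E_torsion : full_torsion (base_change iota E) (l ^ e))
    (m n : 'Z_(l ^ e)) (K : point (base_change iota E))
    (K_torsion : K \in torsion (base_change iota E) (l ^ e))
    (u : nat) (u_le_e : (u <= e)%N) (K_order : has_order K (l ^ u))
    (r : nat) (r_lt_e : (r < e)%N)
    (r_dvd : (l ^ r %| gcdn m n)%N) (r_max : ~~ (l ^ r.+1 %| gcdn m n)%N) :
  (exists P Q : point (base_change iota E),
     [/\ P \in torsion (base_change iota E) (l ^ e),
         Q \in torsion (base_change iota E) (l ^ e),
         K = P *+ m + Q *+ n &
         forall T : point (base_change iota E),
           in_span P Q T <-> T \in torsion (base_change iota E) (l ^ e)])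
  <-> (u + r = e)%N.
Proof.
have [T_closed [phi [phiD phi_inj phi_surj]]] := E_torsion.
have mn_ann := Zp_pair_mulrn_eq0 l_prime e_gt0 r_lt_e r_dvd r_max.
split=> [[P [Q [TP TQ EK span]]] | ur_e].
  have /(spans_torsionP T_closed phiD phi_inj phi_surj TP TQ) gen := span.
  suff -> : u = (e - r)%N by rewrite subnK // ltnW.
  apply: has_order_pexp K_order => // c.
  rewrite -mn_ann -(coord_mulrn_eq0 T_closed phiD phi_inj) // EK.
  rewrite (coord_comb T_closed phiD) // comb_mulrn.
  rewrite pair_mulrn.
  (* Multiplication by the coordinate matrix is injective, so K and (m, n) have the same
     annihilators. *)
  apply/eqP/eqP=> [/(generating_comb_eq0 gen)[-> ->] // | [-> ->]].
  by rewrite /comb !mul0r addr0.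
case phiK: (phi K) => [x y].
have K_ann c : (((x, y) : 'Z_(l ^ e) * 'Z_(l ^ e)) *+ c == 0) = (K *+ c == 0).
  by rewrite -phiK (coord_mulrn_eq0 T_closed phiD phi_inj).
(* From r < e and u + r = e follows u > 0, so the order of K exceeds 1. *)
have xy_neq0 : (x, y) != 0.
  apply/negP=> xy0; case: K_order => _ _ /(_ 1%N) K1.
  have /K1[] : (0 < 1 < l ^ u)%N.
    by rewrite pexp_gt1 // lt0n; apply: contraTneq r_lt_e => u0;
      rewrite -leqNgt -ur_e u0.
  by apply/eqP; rewrite -K_ann mulr1n.
have [s [s_lt_e s_dvd s_max]] := Zp_pair_valuation l_prime e_gt0 xy_neq0.
(* The order of K is both l^u and l^(e-s), so its coordinates have the same valuation as (m, n). *)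
have sr : s = r.
  have -> : s = (e - u)%N; last by rewrite -ur_e addKn.
  suff -> : u = (e - s)%N by rewrite subKn // ltnW.
  apply: has_order_pexp K_order => // c.
  by rewrite -K_ann (Zp_pair_mulrn_eq0 l_prime e_gt0 s_lt_e).
rewrite {s s_lt_e}sr in s_dvd s_max.
have [m' [n' [s [t [em en mn1]]]]] :=
  Zp_unimodular_factor l_prime e_gt0 r_dvd r_max.
have [x' [y' [s' [t' [ex ey xy1]]]]] :=
  Zp_unimodular_factor l_prime e_gt0 s_dvd s_max.
(* The rows are matched after removing l^r from both; multiplying back by l^r recovers K. *)
have [p' [q' [xyE gen]]] := unimodular_transfer mn1 xy1.
have [P TP phiP] := phi_surj p'; have [Q TQ phiQ] := phi_surj q'.
exists P, Q; split=> //; last first.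
  apply: (proj2 (spans_torsionP T_closed phiD phi_inj phi_surj TP TQ)).
  by rewrite phiP phiQ.
apply: phi_inj => //; first by rewrite closed_addr ?closed_mulrn.
rewrite (coord_comb T_closed phiD) // phiP phiQ phiK em en -comb_mulrn.
by rewrite -xyE ex ey pair_mulrn.
Qed.
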